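(* There exists $\varepsilon>0$ such that the following holds. Let $G$ be a finitely generated group with a finite symmetric generating set $S$ containing the identity, and let $R_n$ be the random walk on $G$ with respect to $S$. If $$\liminf_{n\to\infty}\,\Pr\left(R_n^3=1\right)>1-\varepsilon,$$ then $x^3=1$ for all $x\in G$ (and therefore $G$ is finite).
   Context: The random walk with respect to $S$ is $R_0=1$, $R_{n+1}=R_nx_n$ with $x_0,x_1,\dots$ i.i.d. uniform on $S$. A set $S$ is symmetric if $S=S^{-1}$. *)

(* Defs.v *)
From HB Require Import structures.
From mathcomp Require Import all_boot all_order all_algebra.
From mathcomp Require Import finmap.
From mathcomp Require Import all_classical all_reals all_analysis.

Set Implicit Arguments.
Unset Strict Implicit.
Unset Printing Implicit Defensive.

Import Order.TTheory GRing.Theory Num.Theory.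

Local Open Scope classical_set_scope.
Local Open Scope ring_scope.

Definition symmetric_set (G : groupType) (S : {fset G}) : Prop :=
  forall s : G, s \in S -> (s^-1)%g \in S.

(* The smallest subgroup of G containing S is G itself. *)
Definition generates (G : groupType) (S : {fset G}) : Prop :=
  forall H : {pred G}, group_closed H -> {subset S <= H} ->
    forall g : G, g \in H.

(* Random variables with values in G carry the discrete sigma-algebra on G. *)
Definition discrete_rv (G : groupType) (d : measure_display)
    (T : measurableType d) (X : T -> G) : Prop :=
  forall A : set G, measurable (X @^-1` A).

Definition mutually_independent (G : groupType) (R : realType)
    (d : measure_display) (T : measurableType d) (P : probability T R)
    (X : nat -> T -> G) : Prop :=
  forall (J : {fset nat}) (A : nat -> set G),
    (P (\bigcap_(i in [set` J]) (X i @^-1` A i))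
     = \prod_(i <- J) P (X i @^-1` A i))%E.

Definition uniform_on (G : groupType) (S : {fset G}) (R : realType)
    (d : measure_display) (T : measurableType d) (P : probability T R)
    (X : T -> G) : Prop :=
  forall g : G,
    P (X @^-1` [set g]) =
      (if g \in S then (#|` S|%:R : R)^-1 else 0)%:E.

Definition iid_uniform (G : groupType) (S : {fset G}) (R : realType)
    (d : measure_display) (T : measurableType d) (P : probability T R)
    (X : nat -> T -> G) : Prop :=
  [/\ forall i, discrete_rv (X i),
      forall i, uniform_on S P (X i)
    & mutually_independent P X].

Fixpoint random_walk (G : groupType) (T : Type) (X : nat -> T -> G)
    (n : nat) (w : T) : G :=
  match n with
  | 0%N => 1%g
  | m.+1 => (random_walk X m w * X m w)%g
  end.

(* Main.v *)
Require Import Defs.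
From HB Require Import structures.
From mathcomp Require Import all_boot all_order all_algebra.
From mathcomp Require Import finmap.
From mathcomp Require Import all_classical all_reals all_analysis.
From mathcomp Require Import ring lra.

Set Implicit Arguments.
Unset Strict Implicit.
Unset Printing Implicit Defensive.

Import Order.TTheory GRing.Theory Num.Theory.

Local Open Scope classical_set_scope.
Local Open Scope ring_scope.

(** Write mu_n for the law of R_n, call x bad when x^3 <> 1, and suppose that
    mu_n gives the bad set mass at most eps for all large n.

    The bad set is invariant under conjugation, and this makes left translation
    by any fixed g harmless ([drift_le]): mu_n(x : g x bad) and mu_(n+k)(bad)
    become equal as n grows, where k is such that g is a possible value of
    R_k.  Indeed, conditioning a walk of length n + k on a block of k
    consecutive steps having product g gives a product U g V, which is bad
    exactly when g V U is, and V U has law mu_n whatever the position of the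
    block.  So the indicator of the bad event would have the same correlation
    with each of many independent blocks, and its variance leaves no room for
    that unless the correlation is small.  The argument costs no factor
    depending on S or g, hence eps can be absolute.

    Consequently, for any nine elements h there is one x such that no h x is bad
    ([exists_of_translates]), and the rest is algebra
    ([cube_law_of_translates]).  If x, x g and x^-1 g have trivial cubes,
    then g commutes with g ^ x and g^-1 = g ^ x * g ^ x^-1.  Applied to x itself
    this writes g ^ y as the inverse of g ^ (x y) * g ^ (x^-1 y), and applied to
    x y and x^-1 y it shows that g commutes with both factors.  So every element
    commutes with all its conjugates; the group generated by two elements then
    has class at most two, and g = x^-1 (x g) is a product of two elements of
    trivial cube in such a group, so that g^3 = 1.

    A finitely generated group of exponent three is finite, because adjoining
    one generator z to a finite subgroup H gives a finite subgroup
    ([finite_adjoin]). *)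

(** * Groups in which many translates have trivial cubes *)

Section CubeLaw.
Variable G : groupType.
Implicit Types (g h x y z u v : G) (hs : seq G).
Local Open Scope group_scope.

Lemma cubeE x : x ^+ 3 = x * x * x.
Proof. by rewrite expgS expg2 mulgA. Qed.

Lemma cube_rot x y : (x * y) ^+ 3 = 1 -> (y * x) ^+ 3 = 1.
Proof.
move=> xy1; apply: (mulgI x); by rewrite mulg1 -[RHS]mul1g -xy1 !cubeE !mulgA.
Qed.

Lemma cube_inv x : x ^+ 3 = 1 -> x^-1 ^+ 3 = 1.
Proof. by move=> x1; rewrite expVgn x1 invg1. Qed.

Lemma cube_sqr x : x ^+ 3 = 1 -> x * x = x^-1.
Proof. by move=> x1; apply: (mulIg x); rewrite mulVg -cubeE. Qed.

(** Since [x ^+ 3 = 1], the words [(x * g) ^+ 3] and [(x^-1 * g) ^+ 3] are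
    the products of [g], [g ^ x] and [g ^ x^-1] in the two cyclic orders, so
    both vanish only if the three conjugates commute. *)
Lemma commute_conj_of_cubes x g :
    x ^+ 3 = 1 -> (x * g) ^+ 3 = 1 -> (x^-1 * g) ^+ 3 = 1 ->
  commute g (g ^ x) /\ g * (g ^ x * g ^ x^-1) = 1.
Proof.
move=> x3 xg3 xVg3; have xx := cube_sqr x3; have VV := cube_sqr (cube_inv x3).
rewrite invgK in VV.
have cbg : g ^ x^-1 * g ^ x * g = 1.
  rewrite -xg3 cubeE !conjgE invgK !mulgA; congr (_ * _ * _ * _).
  by rewrite -(mulgA _ x^-1) VV.
have bcg : g ^ x * g ^ x^-1 * g = 1.
  rewrite -xVg3 cubeE !conjgE invgK !mulgA; congr (_ * _ * _ * _).
  by rewrite -(mulgA _ x) xx.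
have bc : g ^ x * g ^ x^-1 = g^-1 by apply: (mulIg g); rewrite bcg mulVg.
split; last by rewrite bc mulgV.
have cb : commute (g ^ x) (g ^ x^-1).
  by apply: (mulIg g); rewrite bcg cbg.
have gE : g = (g ^ x * g ^ x^-1)^-1 by rewrite bc invgK.
by rewrite {1}gE; apply/commute_sym/commuteV/commuteM.
Qed.

(** Conjugating by [y] the relation satisfied by [x] writes [g ^ y] as the
    inverse of [g ^ (x * y) * g ^ (x^-1 * y)]; the previous lemma for
    [x * y] and for [x^-1 * y] then makes [g] commute with both factors.  Up to
    rotation and inversion, the nine cubes that have to vanish are cubes of left
    translates of [x]. *)
Lemma commute_conj_of_translates g y :
    (forall hs, (size hs <= 9)%N ->
      exists x, {in hs, forall h, (h * x) ^+ 3 = 1}) ->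
  commute g (g ^ y).
Proof.
pose hs := [:: 1; g; g^-1; y; y * g; y * g^-1; y^-1; g^-1 * y^-1; g * y^-1].
move=> /(_ hs isT)[x xhs].
have cube h : h \in hs -> (h * x) ^+ 3 = 1 by exact: xhs.
have cubeV h u : h \in hs -> h * x = u^-1 -> u ^+ 3 = 1.
  by move=> /cube + hE; rewrite hE => /cube_inv; rewrite invgK.
have cubeVr h u : h \in hs -> x * h = u^-1 -> u ^+ 3 = 1.
  by move=> /cube/cube_rot + hE; rewrite hE => /cube_inv; rewrite invgK.
have cuber h : h \in hs -> (x * h) ^+ 3 = 1 by move/cube/cube_rot.
have [_ gx] : commute g (g ^ x) /\ g * (g ^ x * g ^ x^-1) = 1.
  apply: commute_conj_of_cubes.
  - by rewrite -(mul1g x) cube // !inE eqxx.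
  - by rewrite cuber // !inE eqxx ?orbT.
  - by apply: (cubeV g^-1); rewrite ?invgM ?invgK // !inE eqxx ?orbT.
have [ga _] : commute g (g ^ (x * y)) /\
    g * (g ^ (x * y) * g ^ (x * y)^-1) = 1.
  apply: commute_conj_of_cubes.
  - by rewrite cuber // !inE eqxx ?orbT.
  - by rewrite -mulgA cuber // !inE eqxx ?orbT.
  - apply: cube_rot; apply: (cubeVr (y * g^-1)); last first.
      by rewrite !invgM !invgK mulgA.
    by rewrite !inE eqxx ?orbT.
have [gb _] : commute g (g ^ (x^-1 * y)) /\
    g * (g ^ (x^-1 * y) * g ^ (x^-1 * y)^-1) = 1.
  apply: commute_conj_of_cubes.
  - by apply: (cubeV y^-1); rewrite ?invgM ?invgK // !inE eqxx ?orbT.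
  - apply: (cubeV (g^-1 * y^-1)); last by rewrite !invgM !invgK mulgA.
    by rewrite !inE eqxx ?orbT.
  - by rewrite invgM invgK cube_rot // mulgA cube // !inE eqxx ?orbT.
have gE : g = (g ^ x * g ^ x^-1)^-1 by rewrite -(mulg1_eq gx) invgK.
rewrite {2}gE conjVg conjMg -!conjgM.
by apply/commuteV/commuteM.
Qed.

(** The commutator of [u] and [v] is a product of conjugates of [u] and [u^-1],
    and also of conjugates of [v] and [v^-1], hence central in the group
    generated by [u] and [v].  With [c] its inverse, conjugating
    [v ^+ 3 = 1] by [u] gives [c ^+ 3 = 1], and collecting letters gives
    [(u * v) ^+ 3 = u ^+ 3 * v ^+ 3 * c ^+ 3]. *)
Lemma cube_mul_of_commute_conj u v :
    (forall g y, commute g (g ^ y)) -> u ^+ 3 = 1 -> v ^+ 3 = 1 ->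
  (u * v) ^+ 3 = 1.
Proof.
move=> comm u3 v3; pose w := [~ u, v].
have uw : commute u w.
  by rewrite /w commgEl; apply: commuteM => //; exact: commuteV.
have vw : commute v w.
  by rewrite /w commgEr conjVg; apply: commuteM => //; exact: commuteV.
pose c := w^-1.
have uc : commute u c by exact: commuteV.
have vc : commute v c by exact: commuteV.
have vuE : v * u = u * v * c by rewrite (commgC u v) mulgK.
have c3 : c ^+ 3 = 1.
  have : (v ^ u) ^+ 3 = 1 by rewrite -conjXg v3 conj1g.
  rewrite conjgE vuE -mulgA mulKg expgMn // v3 mul1g; exact.
transitivity (u ^+ 3 * v ^+ 3 * c ^+ 3); last by rewrite u3 v3 c3 !mulg1.
have vu_ z : v * (u * z) = u * (v * (c * z)) by rewrite !mulgA vuE.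
have cu_ z : c * (u * z) = u * (c * z) by rewrite !mulgA uc.
have cv_ z : c * (v * z) = v * (c * z) by rewrite !mulgA vc.
(* the trailing [1] lets the three collection rules, which expect a letter to
   their right, apply up to the end of the word *)
rewrite !cubeE -[LHS]mulg1 -[RHS]mulg1 -!mulgA.
by rewrite !(vu_, cu_, cv_).
Qed.

Lemma cube_law_of_translates :
    (forall hs, (size hs <= 9)%N ->
      exists x, {in hs, forall h, (h * x) ^+ 3 = 1}) ->
  forall g, g ^+ 3 = 1.
Proof.
move=> ex g; have [x xhs] := ex [:: 1; g] isT.
rewrite -(mulKg x g); apply: cube_mul_of_commute_conj.
- by move=> h y; exact: commute_conj_of_translates.
- by apply: cube_inv; rewrite -(mul1g x) xhs // !inE eqxx.
- by apply: cube_rot; rewrite xhs // !inE eqxx orbT.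
Qed.

End CubeLaw.

(** * Finiteness in exponent three *)

Section Finiteness.
Variable G : groupType.
Hypothesis cube1 : forall x : G, (x ^+ 3)%g = 1%g.
Implicit Types (h k x y z : G) (H : set G).
Local Open Scope group_scope.

Let sqr x : x * x = x^-1. Proof. exact: cube_sqr. Qed.

(** Under [cube1] these are the subgroups, as [x^-1 = x * x]. *)
Definition closed_mul H := H 1 /\ forall x y, H x -> H y -> H (x * y).

Lemma closed_mulV H x : closed_mul H -> H x -> H x^-1.
Proof. by case=> _ HM Hx; rewrite -sqr; exact: HM. Qed.

(** The law [(k * z) ^+ 3 = 1] reads [z * k * z = k^-1 * z^-1 * k^-1], so a
    product alternating between [H] and powers of [z] shortens as soon as two
    equal powers of [z] follow one another.  Longer alternations collapse
    too: [z * b * z^-1 * c * z = (z * b * z) * (z * c * z)] is a single [z] up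
    to factors from [H].  Hence the group generated by [H] and [z] is covered by
    the four sets [H], [HzH], [Hz^-1H] and [HzHz^-1H]. *)
Lemma finite_adjoin H z : finite_set H -> closed_mul H ->
  exists K : set G, [/\ finite_set K, closed_mul K, H `<=` K & K z].
Proof.
move=> finH clH; have [H1 HM] := clH; have HV := @closed_mulV _ _ clH.
have fold k : z * k * z = k^-1 * z^-1 * k^-1.
  rewrite -!invgM; apply/esym/mulg1_eq.
  by rewrite -(cube1 (k * z)) cubeE !mulgA.
have foldV k : z^-1 * k * z = z * k^-1 * z^-1 * k^-1.
  (* the letter [z^-1] is read as [z * z] *)
  transitivity (z * (z * k * z)); first by rewrite -[in LHS](sqr z) !mulgA.
  by rewrite fold !mulgA.
have fold' k : z^-1 * k^-1 * z^-1 = k * z * k.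
  by apply: invg_inj; rewrite !invgM !invgK !mulgA fold.
pose K : set G := [set x | exists a b c, [/\ H a, H b, H c &
  [\/ x = a, x = a * z * c, x = a * z^-1 * c | x = a * z * b * z^-1 * c]]].
have KH x h : K x -> H h -> K (x * h).
  case=> a [b] [c] [Ha Hb Hc [] ->] Hh.
  - by exists (a * h), 1, 1; split; [exact: HM | | | constructor 1].
  - exists a, 1, (c * h); split; [by [] | by [] | exact: HM |].
    by constructor 2; rewrite !mulgA.
  - exists a, 1, (c * h); split; [by [] | by [] | exact: HM |].
    by constructor 3; rewrite !mulgA.
  - exists a, b, (c * h); split; [by [] | by [] | exact: HM |].
    by constructor 4; rewrite !mulgA.
have Kz x : K x -> K (x * z).
  case=> a [b] [c] [Ha Hb Hc [] ->].
  - by exists a, 1, 1; split => //; constructor 2; rewrite mulg1.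
  - exists (a * c^-1), 1, c^-1; split; [exact/HM/HV | | exact: HV |] => //.
    by constructor 3; rewrite -!(mulgA a) fold !mulgA.
  - exists a, c^-1, c^-1; split; [| exact: HV | exact: HV |] => //.
    by constructor 4; rewrite -!(mulgA a) foldV !mulgA.
  - exists (a * b^-1 * (c * b)), 1, (c * b * c^-1); split.
    + by apply: (HM); apply: (HM) => //; exact: HV.
    + by [].
    + by apply: (HM); [apply: (HM) | exact: HV].
    constructor 2.
    have -> : a * z * b * z^-1 * c * z = a * ((z * b * z) * (z * c * z)).
      by rewrite -(sqr z) !mulgA.
    rewrite !fold.
    have -> : a * (b^-1 * z^-1 * b^-1 * (c^-1 * z^-1 * c^-1)) =
        a * b^-1 * (z^-1 * (b^-1 * c^-1) * z^-1) * c^-1 by rewrite !mulgA.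
    by rewrite -invgM fold' !mulgA.
have KV x : K x -> K (x * z^-1).
  by move=> Kx; rewrite -sqr mulgA; apply/Kz/Kz.
have HK : H `<=` K by move=> h Hh; exists h, 1, 1; split => //; constructor 1.
exists K; split => //.
- pose F (t : G * G * G * 'I_4) := let: (a, b, c, i) := t in
    nth 1 [:: a; a * z * c; a * z^-1 * c; a * z * b * z^-1 * c] i.
  apply: (@sub_finite_set _ _ (F @` (H `*` H `*` H `*` setT))).
    move=> x [a] [b] [c] [Ha Hb Hc [] ->].
    + by exists (a, b, c, inord 0) => //=; rewrite inordK.
    + by exists (a, b, c, inord 1) => //=; rewrite inordK.
    + by exists (a, b, c, inord 2) => //=; rewrite inordK.
    + by exists (a, b, c, inord 3) => //=; rewrite inordK.
  by apply: finite_image; do 3 apply: finite_setX => //.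
- split; first exact: HK.
  (* the right factor is multiplied in letter by letter *)
  move=> x y Kx [a] [b] [c] [Ha Hb Hc [] ->]; rewrite ?mulgA.
  + exact: KH.
  + by apply: (KH) => //; apply/Kz/KH.
  + by apply: (KH) => //; apply/KV/KH.
  + by apply: (KH) => //; apply/KV/KH => //; apply/Kz/KH.
- by exists 1, 1, 1; split => //; constructor 2; rewrite mul1g mulg1.
Qed.

Lemma finite_span (s : seq G) :
  exists H : set G, [/\ finite_set H, closed_mul H & {in s, forall x, H x}].
Proof.
elim: s => [|z s [H [finH clH sH]]].
  exists [set 1]; split => //; split => // x y -> ->; exact: mulg1.
have [K [finK clK HK Kz]] := finite_adjoin z finH clH.
by exists K; split => // x; rewrite inE => /predU1P[->//|/sH/HK].
Qed.

Lemma finite_of_generates (S : {fset G}) : generates S -> finite_set [set: G].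
Proof.
move=> genS; have [H [finH clH SH]] := finite_span S.
apply: sub_finite_set finH => x _.
suff : x \in [pred y | `[< H y >]] by move/asboolP.
apply: genS => [|s /SH Hs]; last by apply/asboolP.
split=> [|y t]; first by apply/asboolP; case: clH.
move=> /asboolP Hy /asboolP Ht; apply/asboolP.
case: (clH) => _ HM; apply: HM => //; exact: closed_mulV.
Qed.

End Finiteness.

(** * Symmetric generating sets *)

(** Symmetry turns generation as a group into generation as a monoid: the
    elements such that they and their inverse satisfy [Q] form a subgroup. *)
Lemma generates_ind (G : groupType) (S : {fset G}) (Q : G -> Prop) :
    symmetric_set S -> generates S ->
    Q 1%g -> (forall s, s \in S -> Q s) ->
    (forall x y, Q x -> Q y -> Q (x * y)%g) ->
  forall g, Q g.
Proof.
move=> symS genS Q1 QS QM g.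
suff : g \in [pred x | `[< Q x /\ Q (x^-1)%g >]] by case/asboolP.
apply: genS => [|s sS]; last by apply/asboolP; split; apply: QS; rewrite ?symS.
split=> [|x y]; first by apply/asboolP; rewrite invg1.
move=> /asboolP[Qx QVx] /asboolP[Qy QVy]; apply/asboolP.
by rewrite invgF; split; exact: QM.
Qed.

Lemma countable_generates (G : groupType) (S : {fset G}) :
  symmetric_set S -> generates S -> countable [set: G].
Proof.
move=> symS genS; pose f (l : seq S) : G := (\prod_(s <- l) val s)%g.
suff -> : [set: G] = range f.
  exact: card_le_trans (card_image_le _ _) (countableP _).
apply/seteqP; split=> // g _; move: g; apply: (generates_ind symS genS).
- by exists [::]; rewrite // /f big_nil.
- by move=> s sS; exists [:: [` sS]%fset]; rewrite // /f big_seq1.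
- by move=> x y [l _ <-] [m _ <-]; exists (l ++ m); rewrite // /f big_cat.
Qed.

(** * Expectations along the walk *)

Section WalkMean.
Variables (R : archiRealFieldType) (G : groupType) (S : {fset G}).
Hypothesis S1 : 1%g \in S.
Implicit Types (n k j : nat) (phi psi : G -> R) (g h x y : G).

(** The expectation of [phi] at the [n]-th point of the walk, as a finite
    average that involves no probability space. *)
Fixpoint walk_mean n phi : R :=
  match n with
  | 0%N => phi 1%g
  | m.+1 => walk_mean m (fun x => #|` S|%:R^-1 * \sum_(s <- S) phi (x * s)%g)
  end.

Let card_gt0 : 0 < #|` S|%:R :> R.
Proof. by rewrite ltr0n cardfs_gt0; apply/fset0Pn; exists 1%g. Qed.

Lemma eq_walk_mean n phi psi : phi =1 psi -> walk_mean n phi = walk_mean n psi.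
Proof. by move=> /funext ->. Qed.

Lemma walk_meanD n phi psi :
  walk_mean n (fun x => phi x + psi x) = walk_mean n phi + walk_mean n psi.
Proof.
elim: n phi psi => [//|n IH] phi psi /=; rewrite -IH; apply: eq_walk_mean => x.
by rewrite big_split /= mulrDr.
Qed.

Lemma walk_meanZ n a phi :
  walk_mean n (fun x => a * phi x) = a * walk_mean n phi.
Proof.
elim: n phi => [//|n IH] phi /=; rewrite -IH; apply: eq_walk_mean => x.
by rewrite -mulr_sumr mulrCA.
Qed.

Lemma walk_meanB n phi psi :
  walk_mean n (fun x => phi x - psi x) = walk_mean n phi - walk_mean n psi.
Proof.
rewrite walk_meanD -[in RHS]mulN1r -walk_meanZ; congr (_ + _).
by apply: eq_walk_mean => x; rewrite mulN1r.
Qed.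

Lemma walk_mean_cst n a : walk_mean n (fun=> a) = a.
Proof.
elim: n a => [//|n IH] a /=; rewrite -[RHS]IH; apply: eq_walk_mean => x.
rewrite big_const_seq count_predT iter_addr_0.
rewrite -[X in _ * X]mulr_natl mulrA mulVf ?mul1r //.
exact: lt0r_neq0.
Qed.

Lemma walk_mean_sum n (I : Type) (r : seq I) (F : I -> G -> R) :
  walk_mean n (fun x => \sum_(i <- r) F i x) = \sum_(i <- r) walk_mean n (F i).
Proof.
elim: r => [|i r IH].
  rewrite big_nil -[RHS](walk_mean_cst n); apply: eq_walk_mean => x.
  by rewrite big_nil.
rewrite big_cons -IH -walk_meanD; apply: eq_walk_mean => x.
by rewrite big_cons.
Qed.

Lemma le_walk_mean n phi psi :
  (forall x, phi x <= psi x) -> walk_mean n phi <= walk_mean n psi.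
Proof.
elim: n phi psi => [|n IH] phi psi le_pp /=; first exact: le_pp.
apply: IH => x.
by rewrite ler_pM2l ?invr_gt0 //; apply: ler_sum.
Qed.

Lemma walk_mean_add m n phi :
  walk_mean (m + n) phi =
    walk_mean m (fun x => walk_mean n (fun y => phi (x * y)%g)).
Proof.
elim: n phi => [|n IH] phi.
  by rewrite addn0; apply: eq_walk_mean => x /=; rewrite mulg1.
rewrite addnS /= IH; apply: eq_walk_mean => x; apply: eq_walk_mean => y.
by under eq_bigr do rewrite -mulgA.
Qed.

Lemma walk_mean_swap m n (F : G -> G -> R) :
  walk_mean m (fun x => walk_mean n (F x)) =
    walk_mean n (fun y => walk_mean m (F^~ y)).
Proof.
elim: n F => [//|n IH] F /=; rewrite IH; apply: eq_walk_mean => y.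
by rewrite walk_meanZ walk_mean_sum.
Qed.

(** The law of the [k]-th point gives [g] mass at least [p]; testing against
    nonnegative functions is the form in which this bound gets used. *)
Definition mass_ge k (p : R) g :=
  0 < p /\
  forall psi, (forall x, 0 <= psi x) -> p * psi g <= walk_mean k psi.

Lemma mass_ge1 : mass_ge 0 1 1%g.
Proof. by split => // psi _; rewrite mul1r. Qed.

Lemma mass_ge_step s : s \in S -> mass_ge 1 #|` S|%:R^-1 s.
Proof.
move=> sS; split=> [|psi psi0 /=]; first by rewrite invr_gt0.
rewrite ler_pM2l ?invr_gt0 // (big_rem s) //= mul1g lerDl.
exact: sumr_ge0.
Qed.

Lemma mass_geM k l p q g h :
  mass_ge k p g -> mass_ge l q h -> mass_ge (k + l) (p * q) (g * h)%g.
Proof.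
move=> [p0 pP] [q0 qP]; split=> [|psi psi0]; first exact: mulr_gt0.
rewrite walk_mean_add -mulrA.
apply: le_trans (pP (fun x => walk_mean l (fun y => psi (x * y)%g)) _).
  by rewrite ler_pM2l //; exact: (qP (fun y => psi (g * y)%g)).
by move=> x; rewrite -(walk_mean_cst l 0); apply: le_walk_mean.
Qed.

Lemma mass_ge_generates : symmetric_set S -> generates S ->
  forall g, exists k p, mass_ge k p g.
Proof.
move=> symS genS; apply: (generates_ind symS genS).
- by exists 0%N, 1; exact: mass_ge1.
- by move=> s sS; exists 1%N, #|` S|%:R^-1; exact: mass_ge_step.
by move=> x y [k [p xP]] [l [q yP]]; exists (k + l)%N, (p * q); exact: mass_geM.
Qed.

(** The variance of [psi] is at least [p * (psi g - m) ^+ 2], where [m] is its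
    mean; the square is bounded below by its tangents, with slope parametrised
    by [c], so that the bound is linear in [psi g - m] and can be averaged. *)
Lemma variance_ge k p g psi c : mass_ge k p g ->
  2 * c * (psi g - walk_mean k psi) - c ^+ 2 / p <=
    walk_mean k (fun x => psi x ^+ 2) - walk_mean k psi ^+ 2.
Proof.
move=> [p0 /(_ (fun x => (psi x - walk_mean k psi) ^+ 2))] /=.
move=> /(_ (fun x => sqr_ge0 _)); set m := walk_mean k psi.
have -> : walk_mean k (fun x => (psi x - m) ^+ 2) =
    walk_mean k (fun x => psi x ^+ 2) - m ^+ 2.
  rewrite (@eq_walk_mean _ _
    (fun x => psi x ^+ 2 + ((- 2 * m) * psi x + m ^+ 2))).
    rewrite !walk_meanD walk_meanZ walk_mean_cst -/m; ring.
  by move=> x; ring.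
apply: le_trans; rewrite -subr_ge0.
have -> : p * (psi g - m) ^+ 2 - (2 * c * (psi g - m) - c ^+ 2 / p) =
    p * (psi g - m - c / p) ^+ 2 by field; exact: lt0r_neq0.
by rewrite mulr_ge0 ?sqr_ge0 // ltW.
Qed.

(** * Insertion of a fixed element into the walk *)

Section Insertion.
Variables (phi : G -> R) (k : nat) (p : R) (g : G).
Hypothesis phiC : forall x y, phi (x * y)%g = phi (y * x)%g.
Hypothesis phi01 : forall x, 0 <= phi x <= 1.
Hypothesis gP : mass_ge k p g.

(** The second moment of the conditional expectation, given the first [j]
    steps, of [phi] at the [n]-th point. *)
Let energy n j :=
  walk_mean j (fun x => walk_mean (n - j) (fun y => phi (x * y)%g) ^+ 2).

Let drift n := walk_mean n (fun x => phi (g * x)%g) - walk_mean (n + k) phi.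

(** Revealing the [k] steps after the [j]-th raises the energy by the mean
    conditional variance, which [variance_ge] bounds using the event that their
    product is [g].  By [phiC] the element [g], inserted at time [j], can be
    brought to the front, so the gain does not depend on [j]. *)
Lemma energy_step n c j : (j <= n)%N ->
  2 * c * drift n - c ^+ 2 / p <= energy (n + k) (j + k) - energy (n + k) j.
Proof.
move=> jn; pose h x := walk_mean (n - j) (fun z => phi (x * z)%g).
have mean_h x : walk_mean k (fun y => h (x * y)%g) =
    walk_mean (n + k - j) (fun y => phi (x * y)%g).
  rewrite addnC -addnBA // walk_mean_add; apply: eq_walk_mean => y.
  by apply: eq_walk_mean => z; rewrite mulgA.
have -> : energy (n + k) (j + k) - energy (n + k) j =
    walk_mean j (fun x => walk_mean k (fun y => h (x * y)%g ^+ 2) -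
      walk_mean k (fun y => h (x * y)%g) ^+ 2).
  rewrite /energy subnDr walk_mean_add walk_meanB.
  by congr (_ - _); apply: eq_walk_mean => x; rewrite mean_h.
have -> : 2 * c * drift n - c ^+ 2 / p =
    walk_mean j (fun x => 2 * c * (h (x * g)%g -
      walk_mean k (fun y => h (x * y)%g)) - c ^+ 2 / p).
  rewrite walk_meanD walk_mean_cst walk_meanZ walk_meanB.
  congr (_ * (_ - _) + _).
    rewrite -{1}(subnK jn) walk_mean_add walk_mean_swap.
    apply: eq_walk_mean => x; apply: eq_walk_mean => z.
    by rewrite mulgA [LHS]phiC mulgA.
  rewrite -(subnKC (leq_trans jn (leq_addr k n))) walk_mean_add.
  by apply: eq_walk_mean => x; rewrite mean_h.
by apply: le_walk_mean => x; apply: (variance_ge (fun y => h (x * y)%g)).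
Qed.

(** The energy stays between 0 and 1, while [energy_step] provides [M]
    successive gains with the same lower bound, which is therefore at most [1 / M]. *)
Lemma drift_le (d : R) : 0 < d -> exists n0, forall n, (n0 <= n)%N ->
  walk_mean n (fun x => phi (g * x)%g) <= walk_mean (n + k) phi + d.
Proof.
move=> d0; have [p0 _] := gP; pose c := d * p.
(* [c] optimises the bound of [energy_step] when the drift is [d]: it is then
   [d ^+ 2 * p], and [M] such gains amount to at least [1] *)
have [M M0 MP] : exists2 M : nat, (0 < M)%N & (d ^+ 2 * p)^-1 <= M%:R :> R.
  exists (Num.truncn (d ^+ 2 * p)^-1).+1 => //; exact/ltW/truncnS_gt.
exists (M * k)%N => n Mn; rewrite -lerBlDl -/(drift n).
have sum_step m : (m <= M)%N ->
    m%:R * (2 * c * drift n - c ^+ 2 / p) <=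
      energy (n + k) (m * k) - energy (n + k) 0.
  elim: m => [|m IH] mM; first by rewrite mul0r mul0n subrr.
  rewrite -natr1 mulrDl mul1r mulSnr.
  have := IH (ltnW mM); have : (m * k <= n)%N.
    by apply: leq_trans Mn; rewrite leq_mul2r ltnW ?orbT.
  move=> /(energy_step c); lra.
have e1 : energy (n + k) (M * k) <= 1.
  rewrite -(walk_mean_cst (M * k) 1); apply: le_walk_mean => x.
  apply: exprn_ile1.
    rewrite -(walk_mean_cst (n + k - M * k) 0); apply: le_walk_mean => y.
    by case/andP: (phi01 (x * y)%g).
  rewrite -[leRHS](walk_mean_cst (n + k - M * k)); apply: le_walk_mean => y.
  by case/andP: (phi01 (x * y)%g).
have e0 : 0 <= energy (n + k) 0 by exact: sqr_ge0.
have := sum_step M (leqnn M).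
have -> : c ^+ 2 / p = d ^+ 2 * p by rewrite /c; field; exact: lt0r_neq0.
have MP' : 1 <= M%:R * (d ^+ 2 * p).
  rewrite -ler_pdivrMr ?div1r //; apply: mulr_gt0 => //; exact: exprn_gt0.
rewrite /c => le1; rewrite leNgt; apply/negP => ltd.
have : M%:R * (2 * (d * p) * d) < M%:R * (2 * (d * p) * drift n).
  rewrite ltr_pM2l ?ltr0n // ltr_pM2l //.
  by have := mulr_gt0 d0 p0; lra.
move: MP' le1 e0 e1; lra.
Qed.

End Insertion.

(** By [drift_le] each translate of [A] eventually has mass at most [e + d];
    the union bound over [hs] then leaves a point outside all of them. *)
Lemma exists_of_translates (A : pred G) (e d : R) n0 (hs : seq G) :
    (forall x y, A (x * y)%g = A (y * x)%g) ->
    (forall g, exists k p, mass_ge k p g) ->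
    (forall n, (n0 <= n)%N -> walk_mean n (fun x => (A x)%:R) <= e) ->
    0 < d -> (size hs)%:R * (e + d) < 1 ->
  exists x, {in hs, forall h, ~~ A (h * x)%g}.
Proof.
move=> AC reachable small d0 hsed.
have translate g : exists n1, forall n, (n1 <= n)%N ->
    walk_mean n (fun x => (A (g * x)%g)%:R) <= e + d.
  have [k [p gP]] := reachable g.
  have [||n1 n1P] := @drift_le (fun x => (A x)%:R) k p g _ _ gP _ d0.
  - by move=> x y; rewrite AC.
  - by move=> x; case: (A x); rewrite ?lexx ler01.
  exists (maxn n0 n1) => n; rewrite geq_max => /andP[n0n n1n].
  apply: le_trans (n1P n n1n) _; rewrite lerD2r; apply: small.
  exact: leq_trans n0n (leq_addr _ _).
have [n nP] : exists n, {in hs, forall h,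
    walk_mean n (fun x => (A (h * x)%g)%:R) <= e + d}.
  suff [n nP] : exists n, forall m, (n <= m)%N -> {in hs, forall h,
      walk_mean m (fun x => (A (h * x)%g)%:R) <= e + d} by exists n; exact: nP.
  elim: (hs) => [|h l [n nP]]; first by exists 0%N.
  have [n1 n1P] := translate h; exists (maxn n n1) => m.
  rewrite geq_max => /andP[nm n1m] h'; rewrite inE => /predU1P[->|].
    exact: n1P.
  exact: nP.
apply: contrapT => none.
suff : 1 <= (size hs)%:R * (e + d) by rewrite leNgt hsed.
rewrite -[leLHS](walk_mean_cst n 1).
apply: (@le_trans _ _ (walk_mean n (fun x => \sum_(h <- hs) (A (h * x)%g)%:R))).
  apply: le_walk_mean => x; have [h hhs Ah] : exists2 h, h \in hs & A (h * x)%g.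
    apply: contrapT => noneh; apply: none; exists x => h hhs.
    by apply/negP => Ah; apply: noneh; exists h.
  by rewrite (big_rem h) //= Ah lerDl sumr_ge0.
rewrite walk_mean_sum; apply: (@le_trans _ _ (\sum_(h <- hs) (e + d))).
  by rewrite big_seq [leRHS]big_seq; apply: ler_sum => h; exact: nP.
by rewrite big_const_seq count_predT iter_addr_0 -[leLHS]mulr_natl.
Qed.

End WalkMean.

(** * The law of the random walk *)

Section Law.
Variables (R : realType) (G : groupType) (S : {fset G}).
Hypotheses (S1 : 1%g \in S) (cG : countable [set: G]).
Variables (d : measure_display) (T : measurableType d) (P : probability T R).
Variable X : nat -> T -> G.
Hypothesis iidX : iid_uniform S P X.

Let mX i : discrete_rv (X i). Proof. by case: iidX. Qed.
Let uX i : uniform_on S P (X i). Proof. by case: iidX. Qed.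

(** Countability of [G] makes the union over the possible last steps
    measurable; uniformity alone gives only that the steps lie in [S] almost
    surely. *)
Lemma random_walk_discrete n : discrete_rv (random_walk X n).
Proof.
elim: n => [|n IH] A.
  rewrite (_ : _ @^-1` A = if `[< A 1%g >] then setT else set0).
    by case: ifP.
  by apply/seteqP; split=> w /=; case: asboolP.
rewrite (_ : _ @^-1` A = \bigcup_g (X n @^-1` [set g] `&`
    random_walk X n @^-1` [set x | A (x * g)%g])); last first.
  apply/seteqP; split=> [w /= Aw|w [g _ [/= <- //]]].
  by exists (X n w).
apply: countable_bigcupT_measurable => // g.
by apply: measurableI; [exact: mX | exact: IH].
Qed.

Lemma measure_split_step n (E : set T) : measurable E ->
  P E = (\sum_(s <- S) P (E `&` X n @^-1` [set s]))%E.
Proof.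
move=> mE; pose B : set T := X n @^-1` [set` S].
have mB : measurable B by exact: mX.
have split_ (D : set T) : measurable D ->
    P (D `&` B) = (\sum_(s <- S) P (D `&` X n @^-1` [set s]))%E.
  move=> mD; rewrite -measure_fbigsetU -?bigcup_fset.
  - congr (P _); apply/seteqP; split=> [w [Dw Bw]|w [s /= sS [Dw /= Xw]]].
      by exists (X n w).
    by split => //; rewrite /B /= Xw.
  - by move=> s _; apply: measurableI => //; exact: mX.
  - by move=> s t _ _ [w [[_ /= <-] [_ /= <-]]].
have PB : P B = 1%E.
  rewrite -(setTI B) split_ //.
  under eq_big_seq => s sS do rewrite setTI uX sS.
  rewrite sumEFin big_const_seq count_predT iter_addr_0 -[X in X%:E]mulr_natl.
  rewrite mulfV // pnatr_eq0 cardfs_eq0; apply/fset0Pn; by exists 1%g.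
have PCB : P (~` B) = 0%E by rewrite probability_setC // PB subee.
transitivity (P (E `\` B) + P (E `&` B))%E; first exact: measureDI.
rewrite split_ // -[RHS]add0e; congr (_ + _)%E.
apply: (subset_measure0 _ _ _ PCB); [exact: measurableD | exact: measurableC |].
by move=> w [].
Qed.

(** For [J] empty this is the law of the [n]-th point.  The constraints on later
    steps make the induction work: conditioning on the [n]-th step turns it into
    one more such constraint. *)
Lemma random_walk_law_indep n (A : set G) (J : {fset nat}) (C : nat -> set G) :
    (forall i, i \in J -> (n <= i)%N) ->
  P (random_walk X n @^-1` A `&` \bigcap_(i in [set` J]) X i @^-1` C i) =
    ((walk_mean S n (fun x => (x \in A)%:R))%:E *
      P (\bigcap_(i in [set` J]) X i @^-1` C i))%E.
Proof.
have mJ (K : {fset nat}) D : measurable (\bigcap_(i in [set` K]) X i @^-1` D i).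
  by apply: bigcap_measurableType => i _; exact: mX.
elim: n A J C => [|n IH] A J C nJ.
  rewrite /=; case: (boolP (1%g \in A)) => [/set_mem A1|/negP A1].
    by rewrite mul1e (_ : _ @^-1` A = setT) ?setTI //; apply/seteqP; split.
  rewrite mul0e (_ : _ @^-1` A = set0) ?set0I ?measure0 //.
  by apply/seteqP; split => // w /= Aw; apply: A1; exact: mem_set.
have nnJ : n \notin J by apply/negP => /nJ; rewrite ltnn.
have [_ _ indep] := iidX.
rewrite (measure_split_step n); last first.
  by apply: measurableI => //; exact: random_walk_discrete.
pose q := fine (P (\bigcap_(i in [set` J]) X i @^-1` C i)).
have qE : P (\bigcap_(i in [set` J]) X i @^-1` C i) = q%:E.
  by rewrite fineK // fin_num_measure.
have step s : s \in S ->
    P (random_walk X n.+1 @^-1` A `&`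
       \bigcap_(i in [set` J]) X i @^-1` C i `&` X n @^-1` [set s]) =
    (walk_mean S n (fun x => (x * s \in A)%g%:R) * (#|` S|%:R^-1 * q))%:E.
  move=> sS; pose C' i := if i == n then [set s] else C i.
  have JC' : \bigcap_(i in [set` J]) X i @^-1` C' i =
      \bigcap_(i in [set` J]) X i @^-1` C i.
    apply: eq_bigcapr => i /= iJ; rewrite /C' ifN //.
    by apply: contraNneq nnJ => <-.
  have CE : \bigcap_(i in [set` (n |` J)%fset]) X i @^-1` C' i =
      X n @^-1` [set s] `&` \bigcap_(i in [set` J]) X i @^-1` C i.
    by rewrite bigcap_fsetU1 JC' /C' eqxx.
  have PC : P (\bigcap_(i in [set` (n |` J)%fset]) X i @^-1` C' i) =
      (#|` S|%:R^-1 * q)%:E.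
    rewrite indep big_fsetU1 //= -indep JC' qE /C' eqxx uX sS.
    by rewrite EFinM.
  rewrite EFinM -PC -[in RHS](_ : (fun x => (x \in [set y | A (y * s)%g])%:R) =
      (fun x => (x * s \in A)%g%:R)); last first.
    by apply/funext => x; congr (_ %:R); rewrite !mem_setE.
  rewrite -IH; last first.
    move=> i; rewrite in_fset1U => /predU1P[-> //|/nJ]; exact: ltnW.
  congr (P _); rewrite CE; apply/seteqP; split=> w /=.
    by move=> [[Aw Cw] <-].
  by move=> [Aw [Xw Cw]]; rewrite Xw.
rewrite (eq_big_seq _ step) sumEFin qE -EFinM; congr (_%:E).
by rewrite /= walk_meanZ walk_mean_sum // -mulr_suml mulrA [X in X * q]mulrC.
Qed.

Lemma random_walk_law n (A : set G) :
  P (random_walk X n @^-1` A) = (walk_mean S n (fun x => (x \in A)%:R))%:E.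
Proof.
have := @random_walk_law_indep n A fset0 (fun=> setT).
rewrite bigcap_fset big_seq_fset0 setIT probability_setT mule1; exact.
Qed.

End Law.

Lemma near_of_lt_limn_einf (R : realType) (u : nat -> \bar R) (a : \bar R) :
  (a < limn_einf u)%E -> exists n0, forall n, (n0 <= n)%N -> (a < u n)%E.
Proof.
rewrite limn_einf_lim => lta.
have [n0 an0] : exists n0, (a < einfs u n0)%E.
  apply: contrapT => none; move: lta; rewrite ltNge => /negP; apply.
  apply: lime_le; first exact: is_cvg_einfs.
  by apply: nearW => n; rewrite leNgt; apply/negP => an; apply: none; exists n.
exists n0 => n n0n; apply: lt_le_trans an0 _.
by apply: ereal_inf_lbound; exists n.
Qed.

(** * The gap *)

Theorem theorem5p6 (R : realType) :
  exists eps : R, 0 < eps /\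
    forall (G : groupType) (S : {fset G}),
      symmetric_set S ->
      1%g \in S ->
      generates S ->
      forall (d : measure_display) (T : measurableType d)
             (P : probability T R) (X : nat -> T -> G),
        iid_uniform S P X ->
        ((1 - eps)%:E <
           limn_einf (fun n : nat =>
             P [set w | (random_walk X n w ^+ 3)%g = 1%g]))%E ->
        (forall x : G, (x ^+ 3)%g = 1%g) /\ finite_set [set: G].
Proof.
(* nine translates of mass at most [1 / 20 + 1 / 20] each do not fill [G] *)
exists 20%:R^-1; split=> [|G S symS S1 genS d T P X iidX].
  by rewrite invr_gt0.
move=> /near_of_lt_limn_einf[n0 n0P].
suff cube1 : forall x : G, (x ^+ 3)%g = 1%g.
  by split => //; exact: finite_of_generates genS.
apply: cube_law_of_translates => hs hs9.
pose bad (x : G) := (x ^+ 3)%g != 1%g.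
have [] := @exists_of_translates R G S S1 bad 20%:R^-1 20%:R^-1 n0 hs.
- move=> x y; apply/negb_inj; rewrite !negbK.
  by apply/eqP/eqP; exact: cube_rot.
- exact: mass_ge_generates.
- move=> n /n0P.
  rewrite (@random_walk_law _ _ S S1 _ _ _ P X iidX n
    [set x | (x ^+ 3)%g = 1%g]); last exact: countable_generates genS.
  rewrite lte_fin => lt1.
  have badE : walk_mean S n (fun x => (bad x)%:R) =
      1 - walk_mean S n (fun x => (x \in [set x | (x ^+ 3)%g = 1%g])%:R) :> R.
    rewrite -[X in X - _](walk_mean_cst S1 n) -walk_meanB.
    apply: eq_walk_mean => x.
    rewrite /bad; case: eqP => x3; first by rewrite mem_set // subrr.
    by rewrite memNset // subr0.
  by rewrite badE; lra.
- by rewrite invr_gt0.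
- have : (size hs)%:R <= 9%:R :> R by rewrite ler_nat.
  lra.
by move=> x xP; exists x => h /xP; rewrite /bad negbK => /eqP.
Qed.
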